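(* Let $\Sigma$ be the signature of commutative rings with unit extended by a unary inverse operation symbol ${}^{-1}$. For every conditional $\Sigma$-equation $e$, that is, every universally quantified formula $s_1=s_1' \wedge\dots\wedge s_n=s_n' \rightarrow t=t'$ with $n\ge 0$ and with all $s_i,s_i',t,t'$ being $\Sigma$-terms with variables: $e$ holds in every zero totalized field if and only if $e$ holds in every meadow.
   Context: $\Sigma$ has constants $0,1$, binary operations $+,\cdot$, and unary operations $-$ and ${}^{-1}$; all operations are total. A meadow is a $\Sigma$-algebra that is a commutative ring with unit (possibly trivial) and satisfies $(x^{-1})^{-1}=x$ and $x\cdot(x\cdot x^{-1})=x$ for all $x$. A zero totalized field is a $\Sigma$-algebra that is a commutative ring with $0\neq1$, in which $x\cdot x^{-1}=1$ for all $x\neq 0$, and in which $0^{-1}=0$. *)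

(* Defs.v *)
From Stdlib Require Import List Ring_theory.

Set Implicit Arguments.

Record sigma_algebra : Type := SigmaAlgebra {
  carrier :> Type;
  zero : carrier;
  one : carrier;
  add : carrier -> carrier -> carrier;
  mul : carrier -> carrier -> carrier;
  opp : carrier -> carrier;
  inv : carrier -> carrier
}.

Declare Scope sigma_scope.
Delimit Scope sigma_scope with sigma.
Notation "0" := (zero _) : sigma_scope.
Notation "1" := (one _) : sigma_scope.
Notation "x + y" := (add _ x y) : sigma_scope.
Notation "x * y" := (mul _ x y) : sigma_scope.
Notation "- x" := (opp _ x) : sigma_scope.
Notation "x ^-1" := (inv _ x)
  (at level 1, left associativity, format "x ^-1") : sigma_scope.
Local Open Scope sigma_scope.

(* [ring_theory] describes commutative rings with unit and does not require
   [0 <> 1].  It expects a subtraction, which is not in the signature and is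
   therefore supplied as a derived operation. *)
Definition commutative_ring (A : sigma_algebra) : Prop :=
  ring_theory (zero A) (one A) (add A) (mul A)
    (fun x y => x + - y) (opp A) (@eq A).

Definition meadow (A : sigma_algebra) : Prop :=
  commutative_ring A /\
  (forall x : A, (x^-1)^-1 = x) /\
  (forall x : A, x * (x * x^-1) = x).

Definition zero_totalized_field (A : sigma_algebra) : Prop :=
  commutative_ring A /\
  (0 : A) <> 1 /\
  (forall x : A, x <> 0 -> x * x^-1 = 1) /\
  (0 : A)^-1 = 0.

Inductive term : Type :=
| Var (i : nat)
| Zero
| One
| Add (s t : term)
| Mul (s t : term)
| Opp (t : term)
| Inv (t : term).

Fixpoint eval (A : sigma_algebra) (v : nat -> A) (t : term) : A :=
  match t with
  | Var i => v i
  | Zero => 0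
  | One => 1
  | Add s t => eval A v s + eval A v t
  | Mul s t => eval A v s * eval A v t
  | Opp t => - eval A v t
  | Inv t => (eval A v t)^-1
  end.

Record equation : Type := Equation { lhs : term; rhs : term }.

Record conditional_equation : Type := ConditionalEquation {
  premises : list equation;
  conclusion : equation
}.

Definition satisfies (A : sigma_algebra) (v : nat -> A) (q : equation) : Prop :=
  eval A v (lhs q) = eval A v (rhs q).

Definition holds_in (A : sigma_algebra) (e : conditional_equation) : Prop :=
  forall v : nat -> A,
    Forall (satisfies A v) (premises e) -> satisfies A v (conclusion e).

(* Main.v *)
From Stdlib Require Import List Arith Lia Cantor Ring.
From Stdlib Require Import ClassicalEpsilon FunctionalExtensionality.
From Stdlib Require Import PropExtensionality ProofIrrelevance.
Require Import Defs.

(** Every zero totalized field is a meadow, which gives one direction.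
    Conversely, let a valuation in a meadow satisfy the premises and suppose
    that [d = t - t'] is nonzero.  Starting from the idempotent [d * d^-1],
    run through the countably many terms [u] and multiply the current
    idempotent by [u * u^-1] whenever the product is nonzero.  This yields a
    decreasing sequence of nonzero idempotents [e]; identify two terms when
    some [e] equalizes their values.  Each term [u] is then either
    identified with [0] or satisfies [u * u^-1 = 1], so the quotient is a
    zero totalized field, in which the premises hold and [t = t'] fails.
    Only the submeadow generated by the valuation matters, hence countably
    many steps replace Zorn's lemma. *)

Local Open Scope sigma_scope.

(** * Enumeration of terms *)

Fixpoint code (t : term) : nat :=
  match t with
  | Var i => to_nat (0, i)
  | Zero => to_nat (1, 0)
  | One => to_nat (2, 0)
  | Add s t => to_nat (3, to_nat (code s, code t))
  | Mul s t => to_nat (4, to_nat (code s, code t))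
  | Opp t => to_nat (5, code t)
  | Inv t => to_nat (6, code t)
  end%nat.

Lemma to_nat_pair_inj (a b c d : nat) :
  to_nat (a, b) = to_nat (c, d) -> a = c /\ b = d.
Proof. intros H. apply to_nat_inj in H. now injection H. Qed.

Lemma code_inj (s t : term) : code s = code t -> s = t.
Proof.
  revert t; induction s; intros [] H; cbn [code] in H;
    apply to_nat_pair_inj in H; destruct H as [Htag H];
    try discriminate Htag; f_equal; auto;
    apply to_nat_pair_inj in H; destruct H; auto.
Qed.

(** Numbers that code no term get an arbitrary value; only surjectivity onto terms matters. *)
Definition decode (n : nat) : term := epsilon (inhabits Zero) (fun t => code t = n).

Lemma decode_code (t : term) : decode (code t) = t.
Proof.
  apply code_inj.
  exact (epsilon_spec (inhabits Zero) (fun s => code s = code t)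
           (ex_intro _ t eq_refl)).
Qed.

(** A class is encoded as the predicate [R x], so related elements have equal classes by
    extensionality; choice supplies [rep]. *)
Lemma quotient_exists (T : Type) (R : T -> T -> Prop) :
  (forall x, R x x) -> (forall x y, R x y -> R y x) ->
  (forall x y z, R x y -> R y z -> R x z) ->
  exists (Q : Type) (cls : T -> Q) (rep : Q -> T),
    (forall q, cls (rep q) = q) /\ (forall x y, cls x = cls y <-> R x y).
Proof.
  intros Rrefl Rsym Rtrans.
  set (cls x := exist (fun P => exists x, P = R x) (R x) (ex_intro _ x eq_refl)).
  assert (cls_surj : forall q, exists x, cls x = q).
  { intros [P [x ->]]. now exists x. }
  exists {P | exists x, P = R x}, cls,
    (fun q => proj1_sig (constructive_indefinite_description _ (cls_surj q))).
  split.
  - intros q.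
    exact (proj2_sig (constructive_indefinite_description _ (cls_surj q))).
  - intros x y; split.
    + intros H. apply (f_equal (@proj1_sig _ _)) in H. cbn in H.
      rewrite H. apply Rrefl.
    + intros H. apply subset_eq_compat.
      apply functional_extensionality; intros z.
      apply propositional_extensionality; split; eauto.
Qed.

(** * Inverses in zero totalized fields and meadows *)

Section Meadow.

Variable A : sigma_algebra.
Hypothesis A_ring : commutative_ring A.
Let A_ring_theory : ring_theory (zero A) (one A) (add A) (mul A)
  (fun x y => x + - y) (opp A) eq := A_ring.
Add Ring A_ring_tactic : A_ring_theory.

Lemma zero_totalized_field_meadow : zero_totalized_field A -> meadow A.
Proof.
  intros (_ & one_neq_0 & mul_inv & inv_0).
  split; [exact A_ring | split]; intros x;
    (destruct (classic (x = 0)) as [-> | x_neq_0];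
     [rewrite ?inv_0; auto; ring |]).
  - assert (inv_neq_0 : x^-1 <> 0).
    { intros H. apply one_neq_0. rewrite <- (mul_inv x x_neq_0), H. ring. }
    (* The product is computed in two ways: cancelling the first pair leaves [x^-1^-1], cancelling
       the last pair leaves [x]. *)
    transitivity (x * x^-1 * x^-1^-1).
    + rewrite mul_inv by assumption. ring.
    + transitivity (x * (x^-1 * x^-1^-1)); [ring |].
      rewrite mul_inv by assumption. ring.
  - rewrite mul_inv by assumption. ring.
Qed.

(** Both [x * a] and [x * b] equal [x * x * a * b]. Hence [a = a * x * a = a * x * b = b * x * b =
    b]. *)
Lemma quasi_inverse_unique (x a b : A) :
  x * (x * a) = x -> a * (a * x) = a ->
  x * (x * b) = x -> b * (b * x) = b -> a = b.
Proof.
  intros Hxa Ha Hxb Hb.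
  assert (Hab : x * a = x * b).
  { transitivity (x * (x * b) * a); [now rewrite Hxb |].
    transitivity (x * (x * a) * b); [ring | now rewrite Hxa]. }
  transitivity (a * (x * a)); [rewrite <- Ha at 1; ring |].
  rewrite Hab.
  transitivity (b * (x * a)); [ring |].
  rewrite Hab. rewrite <- Hb at 3. ring.
Qed.

Hypothesis A_meadow : meadow A.

Lemma meadow_mul_inv (x : A) : x * (x * x^-1) = x.
Proof. apply A_meadow. Qed.

Lemma meadow_inv_mul (x : A) : x^-1 * (x^-1 * x) = x^-1.
Proof.
  destruct A_meadow as (_ & inv_inv & _).
  rewrite <- (inv_inv x) at 3. apply meadow_mul_inv.
Qed.

Lemma meadow_inv_0 : (0 : A)^-1 = 0.
Proof. rewrite <- meadow_inv_mul. ring. Qed.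

(** Multiplication by [e] turns [z^-1] into a quasi-inverse of [e * z], and quasi-inverses are
    unique. This later makes inversion well defined on the quotient. *)
Lemma idempotent_inv_compat (e x y : A) :
  e * e = e -> e * x = e * y -> e * x^-1 = e * y^-1.
Proof.
  assert (quasi_inverse : forall z, e * e = e ->
    (e * z) * ((e * z) * (e * z^-1)) = e * z /\
    (e * z^-1) * ((e * z^-1) * (e * z)) = e * z^-1).
  { intros z Hee; split.
    - transitivity (e * e * e * (z * (z * z^-1))); [ring |].
      now rewrite meadow_mul_inv, !Hee.
    - transitivity (e * e * e * (z^-1 * (z^-1 * z))); [ring |].
      now rewrite meadow_inv_mul, !Hee. }
  intros Hee Hxy.
  destruct (quasi_inverse x Hee), (quasi_inverse y Hee).
  apply quasi_inverse_unique with (e * x); rewrite ?Hxy in *; assumption.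
Qed.

(** * Decreasing sequences of nonzero idempotents *)

Section IdempotentSequence.

Variables (u : nat -> A) (e0 : A).

Fixpoint idem_seq (n : nat) : A :=
  match n with
  | O => e0
  | S n =>
      let e := idem_seq n * (u n * (u n)^-1) in
      if excluded_middle_informative (e = 0) then idem_seq n else e
  end.

Hypothesis e0_idem : e0 * e0 = e0.
Hypothesis e0_neq_0 : e0 <> 0.

Lemma idem_seq_neq_0 (n : nat) : idem_seq n <> 0.
Proof.
  induction n as [| n IH]; cbn; [assumption |].
  now destruct excluded_middle_informative.
Qed.

Lemma idem_seq_idem (n : nat) : idem_seq n * idem_seq n = idem_seq n.
Proof.
  induction n as [| n IH]; cbn; [assumption |].
  destruct excluded_middle_informative; [assumption |].
  set (x := u n).
  transitivity (idem_seq n * idem_seq n * (x * (x * x^-1) * x^-1)); [ring |].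
  now rewrite IH, meadow_mul_inv.
Qed.

Lemma idem_seq_absorb (m n : nat) :
  m <= n -> idem_seq m * idem_seq n = idem_seq n.
Proof.
  induction 1 as [| n _ IH]; [apply idem_seq_idem |].
  cbn. destruct excluded_middle_informative; [assumption |].
  transitivity (idem_seq m * idem_seq n * (u n * (u n)^-1)); [ring |].
  now rewrite IH.
Qed.

(** With [x = u n], a rejected product kills [x = (x * x^-1) * x]; an accepted one has the
    idempotent [x * x^-1] as a factor and so absorbs it. *)
Lemma idem_seq_decides (n : nat) :
  idem_seq (S n) * u n = 0 \/
  idem_seq (S n) * (u n * (u n)^-1) = idem_seq (S n).
Proof.
  cbn. set (x := u n).
  destruct excluded_middle_informative as [H | _]; [left | right].
  - rewrite <- (meadow_mul_inv x).
    transitivity (idem_seq n * (x * x^-1) * x); [ring |].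
    rewrite H. ring.
  - transitivity (idem_seq n * (x * (x * x^-1) * x^-1)); [ring |].
    now rewrite meadow_mul_inv.
Qed.

Lemma idem_seq_equalizes_le (m n : nat) (x y : A) :
  m <= n -> idem_seq m * x = idem_seq m * y ->
  idem_seq n * x = idem_seq n * y.
Proof.
  intros Hmn Hxy. rewrite <- (idem_seq_absorb m n Hmn).
  transitivity (idem_seq n * (idem_seq m * x)); [ring |].
  rewrite Hxy. ring.
Qed.

End IdempotentSequence.

(** * The separating quotient field *)

Lemma separating_field (v : nat -> A) (t t' : term) :
  eval A v t <> eval A v t' ->
  exists (K : sigma_algebra) (w : nat -> K), zero_totalized_field K /\
    (forall q, satisfies A v q -> satisfies K w q) /\
    eval K w t <> eval K w t'.
Proof.
  intros Htt'.
  set (d := eval A v t + - eval A v t').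
  set (u n := eval A v (decode n)).
  set (e := idem_seq u (d * d^-1)).
  assert (e0_idem : d * d^-1 * (d * d^-1) = d * d^-1).
  { transitivity (d * (d * d^-1) * d^-1); [ring |].
    now rewrite meadow_mul_inv. }
  assert (e0_neq_0 : d * d^-1 <> 0).
  { intros H. apply Htt'.
    transitivity (d + eval A v t'); [unfold d; ring |].
    rewrite <- (meadow_mul_inv d), H. ring. }
  pose proof (idem_seq_neq_0 u _ e0_neq_0 : forall n, e n <> 0) as e_neq_0.
  pose proof (idem_seq_idem u _ e0_idem : forall n, e n * e n = e n) as e_idem.
  pose proof (idem_seq_equalizes_le u _ e0_idem : forall m n x y, m <= n ->
    e m * x = e m * y -> e n * x = e n * y) as e_le.
  set (R r s := exists n, e n * eval A v r = e n * eval A v s).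
  assert (R_of_eq : forall r s, eval A v r = eval A v s -> R r s).
  { intros r s H. exists 0%nat. now rewrite H. }
  (* Equalities persist along the sequence, so the larger of two stages serves for both. *)
  assert (R_common : forall r s r' s', R r s -> R r' s' -> exists n,
    e n * eval A v r = e n * eval A v s /\
    e n * eval A v r' = e n * eval A v s').
  { intros r s r' s' [m Hm] [n Hn]. exists (Nat.max m n).
    split; [apply e_le with m | apply e_le with n]; auto; lia. }
  destruct (quotient_exists term R) as (Q & cls & rep & cls_rep & cls_eq).
  { intros r. now apply R_of_eq. }
  { intros r s [n Hn]. now exists n. }
  { intros r s s' H H'. destruct (R_common _ _ _ _ H H') as (n & Hn & Hn').
    exists n. congruence. }
  set (K := SigmaAlgebra (cls Zero) (cls One)
    (fun p q => cls (Add (rep p) (rep q))) (fun p q => cls (Mul (rep p) (rep q)))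
    (fun p => cls (Opp (rep p))) (fun p => cls (Inv (rep p)))).
  assert (R_rep : forall s, R (rep (cls s)) s).
  { intros s. apply cls_eq, cls_rep. }
  assert (cls_add : forall r s, add K (cls r) (cls s) = cls (Add r s)).
  { intros r s. apply cls_eq.
    destruct (R_common _ _ _ _ (R_rep r) (R_rep s)) as (n & Hr & Hs).
    exists n. cbn [eval].
    transitivity (e n * eval A v (rep (cls r)) + e n * eval A v (rep (cls s)));
      [ring |].
    rewrite Hr, Hs. ring. }
  assert (cls_mul : forall r s, mul K (cls r) (cls s) = cls (Mul r s)).
  { intros r s. apply cls_eq.
    destruct (R_common _ _ _ _ (R_rep r) (R_rep s)) as (n & Hr & Hs).
    exists n. cbn [eval].
    transitivity (e n * eval A v (rep (cls r)) * eval A v (rep (cls s)));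
      [ring |].
    rewrite Hr.
    transitivity (eval A v r * (e n * eval A v (rep (cls s)))); [ring |].
    rewrite Hs. ring. }
  assert (cls_opp : forall s, opp K (cls s) = cls (Opp s)).
  { intros s. apply cls_eq. destruct (R_rep s) as [n Hs].
    exists n. cbn [eval].
    transitivity (- (e n * eval A v (rep (cls s)))); [ring |].
    rewrite Hs. ring. }
  assert (cls_inv : forall s, inv K (cls s) = cls (Inv s)).
  { intros s. apply cls_eq. destruct (R_rep s) as [n Hs].
    exists n. cbn [eval]. now apply idempotent_inv_compat. }
  (* Under the valuation by classes of variables, equations true in [A] therefore stay true in
     [K]. *)
  assert (eval_K : forall s, eval K (fun i => cls (Var i)) s = cls s).
  { induction s; cbn [eval]; try reflexivity;
      rewrite ?IHs, ?IHs1, ?IHs2; auto. }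
  exists K, (fun i => cls (Var i)).
  split; [| split].
  - split; [| split; [| split]].
    (* Every element is the class of a term, so each ring law reduces to the same law for values in
       [A]. *)
    + constructor; intros;
        repeat match goal with
          | x : carrier K |- _ =>
              rewrite <- (cls_rep x); generalize (rep x); clear x; intros
        end;
        change (zero K) with (cls Zero); change (one K) with (cls One);
        rewrite ?cls_opp, ?cls_mul, ?cls_add, ?cls_mul, ?cls_add;
        apply cls_eq, R_of_eq; cbn [eval]; ring.
    + intros H. apply cls_eq in H. destruct H as [n Hn].
      apply (e_neq_0 n). cbn [eval] in Hn.
      transitivity (e n * 1); [ring | rewrite <- Hn; ring].
    + intros x. rewrite <- (cls_rep x). generalize (rep x). clear x. intros s Hs.
      (* The stage after [code s] is the one at which the value of [s] has been decided. *)
      rewrite cls_inv, cls_mul. apply cls_eq. exists (S (code s)). cbn [eval].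
      assert (u_code : u (code s) = eval A v s).
      { unfold u. now rewrite decode_code. }
      pose proof (idem_seq_decides u (d * d^-1) (code s)) as Hdec.
      rewrite u_code in Hdec. destruct Hdec as [H | H].
      * exfalso. apply Hs, cls_eq. exists (S (code s)). cbn [eval].
        transitivity (0 : A); [exact H | ring].
      * transitivity (e (S (code s))); [exact H | ring].
    + change (inv K (cls Zero) = cls Zero). rewrite cls_inv.
      apply cls_eq, R_of_eq, meadow_inv_0.
  - intros q Hq. unfold satisfies. rewrite !eval_K. now apply cls_eq, R_of_eq.
  - rewrite !eval_K. intros H. apply cls_eq in H. destruct H as [n Hn].
    apply (e_neq_0 n).
    (* Every [e n] is absorbed by [e 0 = d * d^-1]; if [e n] equalized [t] and [t'], then
       [e n * d = 0] and so [e n = 0]. *)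
    rewrite <- (idem_seq_absorb u _ e0_idem 0 n (Nat.le_0_l n) : e 0%nat * e n = e n).
    change (d * d^-1 * e n = 0). unfold d at 1.
    transitivity ((e n * eval A v t + - (e n * eval A v t')) * d^-1); [ring |].
    rewrite Hn. ring.
Qed.

End Meadow.

Theorem theorem3p11 (e : conditional_equation) :
  (forall A : sigma_algebra, zero_totalized_field A -> holds_in A e) <->
  (forall A : sigma_algebra, meadow A -> holds_in A e).
Proof.
  split.
  - intros He A A_meadow v Hprem.
    apply NNPP. intros Hconcl.
    destruct (separating_field A (proj1 A_meadow) A_meadow v _ _ Hconcl)
      as (K & w & K_field & K_satisfies & K_separates).
    apply K_separates, (He K K_field w).
    now apply Forall_impl with (satisfies A v).
  - intros He A A_field. apply He, zero_totalized_field_meadow;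
      [apply A_field | exact A_field].
Qed.
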